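(* For any Veltman frame $F=\langle W,R,\{S_x\}_{x\in W}\rangle$ and any natural number $k\geq 0$ the following equivalences hold: \[ F\models \mathcal F_{2k} \iff F\models \widetilde{\mathsf R}_k \iff F\models \mathsf R_{2k}. \]
   Context: Modal language: propositional logic with a unary operator $\Box$ (with $\Diamond=\neg\Box\neg$) and a binary operator $\rhd$. Binding conventions: $\neg,\Box,\Diamond$ bind strongest, then $\wedge,\vee$, then $\rhd$, then $\to$ (weakest). A Veltman frame is a triple $\langle W,R,\{S_x\}_{x\in W}\rangle$ with $W\neq\emptyset$; $R$ a transitive binary relation on $W$ with no infinite ascending chain $x_0Rx_1Rx_2\cdots$; and, for each $x$, $S_x$ a reflexive and transitive binary relation on $x{\uparrow}:=\{y\mid xRy\}$ containing the restriction of $R$ to $x{\uparrow}$. A forcing relation $\Vdash$ on the frame is induced by a valuation of propositional variables, commutes with the Boolean connectives, and satisfies: $x\Vdash\Box A$ iff $\forall y\,(xRy\to y\Vdash A)$; $x\Vdash A\rhd B$ iff $\forall y\,\big(xRy\wedge y\Vdash A\to\exists z\,(yS_xz\wedge z\Vdash B)\big)$. For a modal formula or scheme $\mathsf P$, $F\models\mathsf P$ means that under every valuation on $F$, (every instance of) $\mathsf P$ is forced at every world; for a (first-order) sentence in the language $\{R,\{S_x\}_{x\in W}\}$, $F\models$ means truth in $F$ as a relational structure. Frame conditions: ternary relations $\mathcal G_n$ are defined by $\mathcal G_0(x,y,z)=\forall u\,(zRu\Rightarrow yS_xu)$, $\mathcal G_{n+1}(x,y,z)=\forall u\,\big(zRu\Rightarrow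 yS_xu\wedge\forall v\,(uS_xv\Rightarrow\mathcal G_n(z,u,v))\big)$, and $\mathcal F_n=\forall w,x,y,z\,(wRx\wedge xRy\wedge yS_wz\Rightarrow\mathcal G_n(x,y,z))$. Schemes $\widetilde{\mathsf R}_n$ ($A_i,B_i,C_i,E_i$ are placeholders for arbitrary modal formulas): $\mathsf X_0=A_0\rhd B_0$; $\mathsf Y_0=\neg(A_0\rhd\neg C_0)$; $\mathsf Z_0=B_0\wedge\Box C_0$; $\mathsf X_{n+1}=A_{n+1}\rhd B_{n+1}\wedge(\mathsf X_n)$; $\mathsf Y_{n+1}=\neg(A_{n+1}\rhd\neg C_{n+1})\wedge(E_{n+1}\rhd\mathsf Y_n)$; $\mathsf Z_{n+1}=B_{n+1}\wedge(\mathsf X_n)\wedge\Box C_{n+1}\wedge(E_{n+1}\rhd A_n)\wedge(E_{n+1}\rhd\mathsf Z_n)$; $\widetilde{\mathsf R}_n=\mathsf X_n\to\mathsf Y_n\rhd\mathsf Z_n$. Schemes $\mathsf R_n$: here $\Phi[P/Q;\dots]$ means that each occurrence of $P$ in $\Phi$ is (simultaneously) replaced by $Q$, the placeholders being treated as distinct propositional variables during the construction: $\mathsf R_0:=A_0\rhd B_0\to\neg(A_0\rhd\neg C_0)\rhd B_0\wedge\Box C_0$; $\mathsf R_{2n+1}:=\mathsf R_{2n}\big[\neg(A_n\rhd\neg C_n)\,/\,\neg(A_n\rhd\neg C_n)\wedge(E_{n+1}\rhd\Diamond A_{n+1});\ B_n\wedge\Box C_n\,/\,B_n\wedge\Box C_n\wedge(E_{n+1}\rhd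 A_{n+1})\big]$; $\mathsf R_{2n+2}:=\mathsf R_{2n+1}\big[B_n\,/\,B_n\wedge(A_{n+1}\rhd B_{n+1});\ \Diamond A_{n+1}\,/\,\neg(A_{n+1}\rhd\neg C_{n+1});\ (E_{n+1}\rhd A_{n+1})\,/\,(E_{n+1}\rhd A_{n+1})\wedge(E_{n+1}\rhd B_{n+1}\wedge\Box C_{n+1})\big]$. For example, $\mathsf R_1$ is $A_0\rhd B_0\to\neg(A_0\rhd\neg C_0)\wedge(E_1\rhd\Diamond A_1)\rhd B_0\wedge\Box C_0\wedge(E_1\rhd A_1)$, and $\mathsf R_2$ is $A_0\rhd B_0\wedge(A_1\rhd B_1)\to\neg(A_0\rhd\neg C_0)\wedge(E_1\rhd\neg(A_1\rhd\neg C_1))\rhd B_0\wedge(A_1\rhd B_1)\wedge\Box C_0\wedge(E_1\rhd A_1)\wedge(E_1\rhd B_1\wedge\Box C_1)$. *)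

(* Defs.v *)
From Stdlib Require Import Arith List.
Import ListNotations.

(** Modal formulas over a type [V] of propositional variables. *)

Inductive form (V : Type) : Type :=
| Var (p : V)
| Bot
| Neg (A : form V)
| And (A B : form V)
| Or (A B : form V)
| Imp (A B : form V)
| Box (A : form V)
| Rhd (A B : form V).

Arguments Var {V} p.
Arguments Bot {V}.
Arguments Neg {V} A.
Arguments And {V} A B.
Arguments Or {V} A B.
Arguments Imp {V} A B.
Arguments Box {V} A.
Arguments Rhd {V} A B.

Definition Dia {V : Type} (A : form V) : form V := Neg (Box (Neg A)).

Declare Scope modal_scope.
Delimit Scope modal_scope with modal.
Bind Scope modal_scope with form.

Notation "¬ A" := (Neg A) (at level 35, right associativity) : modal_scope.
Notation "□ A" := (Box A) (at level 35, right associativity) : modal_scope.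
Notation "◇ A" := (Dia A) (at level 35, right associativity) : modal_scope.
Notation "A ∧ B" := (And A B) (at level 40, left associativity) : modal_scope.
Notation "A ∨ B" := (Or A B) (at level 40, left associativity) : modal_scope.
Notation "A ▷ B" := (Rhd A B) (at level 50, no associativity) : modal_scope.
Notation "A ⇒ B" := (Imp A B) (at level 60, right associativity) : modal_scope.

Fixpoint subst {V V' : Type} (s : V -> form V') (phi : form V) : form V' :=
  match phi with
  | Var p => s p
  | Bot => Bot
  | Neg A => Neg (subst s A)
  | And A B => And (subst s A) (subst s B)
  | Or A B => Or (subst s A) (subst s B)
  | Imp A B => Imp (subst s A) (subst s B)
  | Box A => Box (subst s A)
  | Rhd A B => Rhd (subst s A) (subst s B)
  end.

(** [vS x] is a relation on the set of [vR]-successors of [x]. *)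

Record veltman_frame : Type := VeltmanFrame {
  world :> Type;
  vR : world -> world -> Prop;
  vS : world -> world -> world -> Prop;
  world_nonempty : inhabited world;
  vR_trans : forall x y z, vR x y -> vR y z -> vR x z;
  vR_no_chain : ~ exists c : nat -> world, forall i, vR (c i) (c (S i));
  vS_dom : forall x y z, vS x y z -> vR x y /\ vR x z;
  vS_refl : forall x y, vR x y -> vS x y y;
  vS_trans : forall x y z u, vS x y z -> vS x z u -> vS x y u;
  vS_vR : forall x y z, vR x y -> vR x z -> vR y z -> vS x y z
}.

Arguments vR {v} _ _.
Arguments vS {v} _ _ _.

Fixpoint forces {F : veltman_frame} (val : nat -> F -> Prop)
    (x : F) (phi : form nat) : Prop :=
  match phi with
  | Var p => val p x
  | Bot => False
  | Neg A => ~ forces val x A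
  | And A B => forces val x A /\ forces val x B
  | Or A B => forces val x A \/ forces val x B
  | Imp A B => forces val x A -> forces val x B
  | Box A => forall y, vR x y -> forces val y A
  | Rhd A B =>
      forall y, vR x y /\ forces val y A ->
        exists z, vS x y z /\ forces val z B
  end.

(** Schemes are formulas whose variables are placeholders; their instances are
    obtained by substituting modal formulas for the placeholders. *)

Inductive placeholder : Type :=
| phA (n : nat) | phB (n : nat) | phC (n : nat) | phE (n : nat).

Definition scheme : Type := form placeholder.
Bind Scope modal_scope with scheme.

Definition valid (F : veltman_frame) (P : scheme) : Prop :=
  forall (s : placeholder -> form nat) (val : nat -> F -> Prop) (x : F),
    forces val x (subst s P).

Definition A_ (n : nat) : scheme := Var (phA n).
Definition B_ (n : nat) : scheme := Var (phB n).
Definition C_ (n : nat) : scheme := Var (phC n).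
Definition E_ (n : nat) : scheme := Var (phE n).

Fixpoint calG (F : veltman_frame) (n : nat) (x y z : F) : Prop :=
  match n with
  | 0 => forall u, vR z u -> vS x y u
  | S m =>
      forall u, vR z u -> vS x y u /\ forall v, vS x u v -> calG F m z u v
  end.

Definition calF (F : veltman_frame) (n : nat) : Prop :=
  forall w x y z : F, vR w x /\ vR x y /\ vS w y z -> calG F n x y z.

Local Open Scope modal_scope.

Fixpoint X_ (n : nat) : scheme :=
  match n with
  | 0 => A_ 0 ▷ B_ 0
  | S m => A_ n ▷ B_ n ∧ (X_ m)
  end.

Fixpoint Y_ (n : nat) : scheme :=
  match n with
  | 0 => ¬ (A_ 0 ▷ ¬ C_ 0)
  | S m => ¬ (A_ n ▷ ¬ C_ n) ∧ (E_ n ▷ Y_ m)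
  end.

Fixpoint Z_ (n : nat) : scheme :=
  match n with
  | 0 => B_ 0 ∧ □ C_ 0
  | S m => B_ n ∧ (X_ m) ∧ □ C_ n ∧ (E_ n ▷ A_ m) ∧ (E_ n ▷ Z_ m)
  end.

Definition Rtilde (n : nat) : scheme := X_ n ⇒ Y_ n ▷ Z_ n.

Definition placeholder_eq_dec (p q : placeholder) : {p = q} + {p <> q}.
Proof. decide equality; apply Nat.eq_dec. Defined.

Definition scheme_eq_dec (P Q : scheme) : {P = Q} + {P <> Q}.
Proof. decide equality; apply placeholder_eq_dec. Defined.

Fixpoint lookup (l : list (scheme * scheme)) (P : scheme) : option scheme :=
  match l with
  | [] => None
  | (P', Q) :: l' => if scheme_eq_dec P P' then Some Q else lookup l' P
  end.

(** [replace l P] is the simultaneous replacement P[P1/Q1; ...; Pk/Qk] for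
    [l = [(P1, Q1); ...; (Pk, Qk)]]: the replaced occurrences are subformulas,
    and nothing is replaced inside the inserted [Qi]. *)

Fixpoint replace (l : list (scheme * scheme)) (P : scheme) : scheme :=
  match lookup l P with
  | Some Q => Q
  | None =>
      match P with
      | Var p => Var p
      | Bot => Bot
      | Neg A => Neg (replace l A)
      | And A B => And (replace l A) (replace l B)
      | Or A B => Or (replace l A) (replace l B)
      | Imp A B => Imp (replace l A) (replace l B)
      | Box A => Box (replace l A)
      | Rhd A B => Rhd (replace l A) (replace l B)
      end
  end.

Definition to_odd (n : nat) : scheme -> scheme :=
  replace
    [ (¬ (A_ n ▷ ¬ C_ n),
       ¬ (A_ n ▷ ¬ C_ n) ∧ (E_ (n + 1) ▷ ◇ A_ (n + 1)));
      (B_ n ∧ □ C_ n,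
       B_ n ∧ □ C_ n ∧ (E_ (n + 1) ▷ A_ (n + 1))) ].

Definition to_even (n : nat) : scheme -> scheme :=
  replace
    [ (B_ n,
       B_ n ∧ (A_ (n + 1) ▷ B_ (n + 1)));
      (◇ A_ (n + 1),
       ¬ (A_ (n + 1) ▷ ¬ C_ (n + 1)));
      (E_ (n + 1) ▷ A_ (n + 1),
       (E_ (n + 1) ▷ A_ (n + 1))
         ∧ (E_ (n + 1) ▷ B_ (n + 1) ∧ □ C_ (n + 1))) ].

Fixpoint Rscheme (m : nat) : scheme :=
  match m with
  | 0 => A_ 0 ▷ B_ 0 ⇒ ¬ (A_ 0 ▷ ¬ C_ 0) ▷ B_ 0 ∧ □ C_ 0
  | S m' =>
      let n := Nat.div2 m' in
      if Nat.even m' then to_odd n (Rscheme m') else to_even n (Rscheme m')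
  end.

Lemma Rscheme_odd (n : nat) :
  Rscheme (2 * n + 1) = to_odd n (Rscheme (2 * n)).
Proof.
rewrite Nat.add_1_r; cbn [Rscheme].
now rewrite Nat.div2_double, Nat.even_even.
Qed.

Lemma Rscheme_even (n : nat) :
  Rscheme (2 * n + 2) = to_even n (Rscheme (2 * n + 1)).
Proof.
replace (2 * n + 2) with (S (S (2 * n))) by ring.
rewrite Nat.add_1_r; cbn [Rscheme].
rewrite Nat.div2_succ_double.
now rewrite Nat.even_succ, Nat.odd_even.
Qed.

Example Rscheme_1 :
  Rscheme 1 =
  (A_ 0 ▷ B_ 0 ⇒
   ¬ (A_ 0 ▷ ¬ C_ 0) ∧ (E_ 1 ▷ ◇ A_ 1) ▷ B_ 0 ∧ □ C_ 0 ∧ (E_ 1 ▷ A_ 1)).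
Proof. reflexivity. Qed.

Example Rscheme_2 :
  Rscheme 2 =
  (A_ 0 ▷ B_ 0 ∧ (A_ 1 ▷ B_ 1) ⇒
   ¬ (A_ 0 ▷ ¬ C_ 0) ∧ (E_ 1 ▷ ¬ (A_ 1 ▷ ¬ C_ 1)) ▷
   B_ 0 ∧ (A_ 1 ▷ B_ 1) ∧ □ C_ 0
     ∧ ((E_ 1 ▷ A_ 1) ∧ (E_ 1 ▷ B_ 1 ∧ □ C_ 1))).
Proof. reflexivity. Qed.

Example Rscheme_4 :
  Rscheme 4 =
  (A_ 0 ▷ B_ 0 ∧ (A_ 1 ▷ B_ 1 ∧ (A_ 2 ▷ B_ 2)) ⇒
   ¬ (A_ 0 ▷ ¬ C_ 0)
     ∧ (E_ 1 ▷ ¬ (A_ 1 ▷ ¬ C_ 1) ∧ (E_ 2 ▷ ¬ (A_ 2 ▷ ¬ C_ 2))) ▷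
   B_ 0 ∧ (A_ 1 ▷ B_ 1 ∧ (A_ 2 ▷ B_ 2)) ∧ □ C_ 0
     ∧ ((E_ 1 ▷ A_ 1)
        ∧ (E_ 1 ▷ B_ 1 ∧ (A_ 2 ▷ B_ 2) ∧ □ C_ 1
                    ∧ ((E_ 2 ▷ A_ 2) ∧ (E_ 2 ▷ B_ 2 ∧ □ C_ 2))))).
Proof. reflexivity. Qed.

(* Main.v *)
Require Import Defs.
From Stdlib Require Import Arith Lia Classical.

(** The condition [calG (2 * k) x y z] and the formula [Z_ k] unfold in step: two
    layers of [calG] correspond to one layer of [Z_].  Call [y] a witness of
    [Y_ k] at [x] when [x R y], [A_k] holds at [y] and [C_k] holds at every
    [S_x]-successor of [y].

    From the frame condition to the scheme: if [w] forces [X_ k] and [x] forces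
    [Y_ k] with witness [y], then [X_ k] sends [y] to some [z] with [y S_w z], and
    [calG (2 * k) x y z] makes [Z_ k] true at [z].  One layer goes as follows.  A
    successor [u] of [z] is an [S_x]-successor of [y], whence [□ C]; if moreover
    [E] holds at [u], then [x] sends [u] to some [v] forcing the lower [Y], whose
    witness [a] is [S_z]-reachable from [u], and the lower [X], true at [z], sends
    [a] to some [b] with [calG] two levels down at [v], [a], [b]
    ([Z_of_calG]).

    From the scheme to the frame condition: given [w R x R y] and [y S_w z], make
    [A_k] true exactly at [y], [B_k] exactly at [z] and [C_k] exactly at the
    [S_x]-successors of [y].  Then [z] is the only world that can force [Z_ k], so
    the scheme puts [Z_ k] at [z].  To test one configuration [u], [v], [a], [b]
    of [calG], let [E_k] be true exactly at [u] and treat [v], [a], [b] in the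
    lower levels the way [x], [y], [z] are treated at the top one
    ([calG_of_pinned]).

    Finally, the replacements that build [Rscheme (2 * k)] touch only the
    innermost level, so this scheme has a closed form ([Rscheme_closed_form]) that
    counts its levels from the outside in, whereas [Rtilde k] counts them from the
    inside out.  Reversing the numbering of the placeholders turns one into the
    other, up to the association of one conjunction ([holds_mirror_Rtilde]). *)

Local Open Scope modal_scope.

(** * Forcing of schemes by valuations of the placeholders *)

(** Forcing with the variables drawn from any type, so that a scheme can be
    evaluated directly, each placeholder standing for a set of worlds. *)
Fixpoint holds {F : veltman_frame} {V : Type} (val : V -> F -> Prop)
    (x : F) (phi : form V) : Prop :=
  match phi with
  | Var p => val p x
  | Bot => False
  | Neg A => ~ holds val x A
  | And A B => holds val x A /\ holds val x B
  | Or A B => holds val x A \/ holds val x B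
  | Imp A B => holds val x A -> holds val x B
  | Box A => forall y, vR x y -> holds val y A
  | Rhd A B =>
      forall y, vR x y /\ holds val y A ->
        exists z, vS x y z /\ holds val z B
  end.

Lemma Rhd_iff (F : veltman_frame) (x : F) (A A' B B' : F -> Prop) :
  (forall t, A t <-> A' t) -> (forall t, B t <-> B' t) ->
  (forall y, vR x y /\ A y -> exists z, vS x y z /\ B z) <->
  (forall y, vR x y /\ A' y -> exists z, vS x y z /\ B' z).
Proof.
intros HA HB; split; intros H y [Hy HAy];
  (destruct (H y) as [z [Hz HBz]]; [split; [easy | now apply HA] |]);
  exists z; split; try easy; now apply HB.
Qed.

Lemma holds_subst (F : veltman_frame) (V V' : Type) (s : V -> form V')
    (val : V' -> F -> Prop) (phi : form V) (x : F) :
  holds val x (subst s phi) <-> holds (fun p t => holds val t (s p)) x phi.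
Proof.
revert x; induction phi as
  [p | | A IHA | A IHA B IHB | A IHA B IHB | A IHA B IHB | A IHA | A IHA B IHB];
  intros x; cbn; try (now apply Rhd_iff);
  try rewrite IHA; try rewrite IHB; try reflexivity.
split; intros H y Hy; now apply IHA, H.
Qed.

Lemma forces_holds (F : veltman_frame) (val : nat -> F -> Prop)
    (phi : form nat) (x : F) :
  forces val x phi <-> holds val x phi.
Proof.
revert x; induction phi as
  [p | | A IHA | A IHA B IHB | A IHA B IHB | A IHA B IHB | A IHA | A IHA B IHB];
  intros x; cbn; try (now apply Rhd_iff);
  try rewrite IHA; try rewrite IHB; try reflexivity.
split; intros H y Hy; now apply IHA, H.
Qed.

Fixpoint occurs {V : Type} (p : V) (phi : form V) : Prop :=
  match phi with
  | Var q => p = q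
  | Bot => False
  | Neg A | Box A => occurs p A
  | And A B | Or A B | Imp A B | Rhd A B => occurs p A \/ occurs p B
  end.

Lemma holds_ext (F : veltman_frame) (V : Type) (val val' : V -> F -> Prop)
    (phi : form V) :
  (forall p t, occurs p phi -> (val p t <-> val' p t)) ->
  forall x, holds val x phi <-> holds val' x phi.
Proof.
induction phi as
  [p | | A IHA | A IHA B IHB | A IHA B IHB | A IHA B IHB | A IHA | A IHA B IHB];
  cbn; intros H x;
  try specialize (IHA ltac:(auto)); try specialize (IHB ltac:(auto));
  try (now apply Rhd_iff);
  try rewrite IHA; try rewrite IHB; try reflexivity.
- now apply H.
- split; intros H' y Hy; now apply IHA, H'.
Qed.

(** An injective numbering of the placeholders by variables, given by its left
    inverse: it lets a single instance of a scheme realize an arbitrary choice of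
    sets of worlds for the placeholders. *)
Definition placeholder_code (p : placeholder) : nat :=
  match p with
  | phA n => 4 * n
  | phB n => 4 * n + 1
  | phC n => 4 * n + 2
  | phE n => 4 * n + 3
  end.

Definition placeholder_decode (m : nat) : placeholder :=
  match m mod 4 with
  | 0 => phA (m / 4)
  | 1 => phB (m / 4)
  | 2 => phC (m / 4)
  | _ => phE (m / 4)
  end.

Lemma placeholder_codeK (p : placeholder) :
  placeholder_decode (placeholder_code p) = p.
Proof.
assert (H : forall n r, r < 4 ->
    (4 * n + r) mod 4 = r /\ (4 * n + r) / 4 = n).
{ intros n r Hr; split; symmetry;
    [apply (Nat.mod_unique _ _ n) | apply (Nat.div_unique _ _ _ r)]; lia. }
unfold placeholder_decode; destruct p as [n | n | n | n]; cbn [placeholder_code].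
- destruct (H n 0 ltac:(lia)) as [H1 H2]; rewrite Nat.add_0_r in H1, H2.
  now rewrite H1, H2.
- now destruct (H n 1 ltac:(lia)) as [-> ->].
- now destruct (H n 2 ltac:(lia)) as [-> ->].
- now destruct (H n 3 ltac:(lia)) as [-> ->].
Qed.

Lemma valid_iff_holds (F : veltman_frame) (P : scheme) :
  valid F P <->
  forall (val : placeholder -> F -> Prop) (x : F), holds val x P.
Proof.
split.
- intros H val x.
  specialize (H (fun p => Var (placeholder_code p))
                (fun m => val (placeholder_decode m)) x).
  apply forces_holds, holds_subst in H.
  revert H; apply holds_ext; intros p t _; cbn.
  now rewrite placeholder_codeK.
- intros H s val x; apply forces_holds, holds_subst, H.
Qed.

(** * From the frame condition to the scheme *)

Definition X_consequent (k : nat) : scheme :=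
  match k with
  | 0 => B_ 0
  | S m => B_ k ∧ X_ m
  end.

Lemma X_unfold (k : nat) : X_ k = (A_ k ▷ X_consequent k).
Proof. now destruct k. Qed.

Lemma Y_witness (F : veltman_frame) (k : nat) (val : placeholder -> F -> Prop)
    (x : F) :
  holds val x (Y_ k) ->
  exists y, vR x y /\ val (phA k) y /\
    forall u, vS x y u -> val (phC k) u.
Proof.
intros HY.
assert (H : holds val x (¬ (A_ k ▷ ¬ C_ k))) by (destruct k; cbn in *; tauto).
apply NNPP; intros Hno; apply H; intros y [Hxy HA].
apply NNPP; intros Hall; apply Hno; exists y; repeat split; try easy.
intros u Hu; apply NNPP; intros HC; apply Hall; now exists u.
Qed.

(** Stated for an arbitrary [calG]-triple rather than below a root [w], since the
    triples reached at the lower levels are governed by another world than the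
    one at the top. *)
Lemma Z_of_calG (F : veltman_frame) (val : placeholder -> F -> Prop) (k : nat) :
  forall x y z : F,
  calG F (2 * k) x y z ->
  (forall u, vS x y u -> val (phC k) u) ->
  holds val x (Y_ k) ->
  holds val z (X_consequent k) ->
  holds val z (Z_ k).
Proof.
induction k as [| k IH]; intros x y z HG HC HY HX.
- split; [exact HX |]; intros u Hu; apply HC, HG, Hu.
- replace (2 * S k) with (S (S (2 * k))) in HG by lia.
  destruct HX as [HB HX], HY as [_ HEY].
  assert (Hstep : forall u, vR z u /\ val (phE (S k)) u ->
      exists a, vS z u a /\ val (phA k) a /\
      exists b, vS z u b /\ holds val b (Z_ k)).
  { intros u [Hzu HE].
    destruct (HG u Hzu) as [Hyu HG1].
    destruct (HEY u) as [v [Huv HYv]].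
    { split; [exact (proj2 (vS_dom _ _ _ _ Hyu)) | exact HE]. }
    destruct (Y_witness _ _ _ _ HYv) as [a [Hva [HA HCa]]].
    destruct (HG1 v Huv a Hva) as [Hua HG2].
    exists a; split; [exact Hua |]; split; [exact HA |].
    pose proof HX as HX'; rewrite X_unfold in HX'.
    destruct (HX' a) as [b [Hab Hb]].
    { split; [exact (proj2 (vS_dom _ _ _ _ Hua)) | exact HA]. }
    exists b; split; [exact (vS_trans _ _ _ _ _ Hua Hab) |].
    exact (IH v a b (HG2 b Hab) HCa HYv Hb). }
  cbn [Z_]; repeat split; [exact HB | exact HX | | |].
  + intros u Hu; apply HC, HG, Hu.
  + intros u Hu; destruct (Hstep u Hu) as [a [Ha [HA _]]]; now exists a.
  + intros u Hu; destruct (Hstep u Hu) as [a [_ [_ Hb]]]; exact Hb.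
Qed.

Lemma valid_Rtilde_of_calF (F : veltman_frame) (k : nat) :
  calF F (2 * k) -> valid F (Rtilde k).
Proof.
intros HF; apply valid_iff_holds; intros val w HX x [Hwx HY].
destruct (Y_witness _ _ _ _ HY) as [y [Hxy [HA HC]]].
pose proof (vR_trans _ _ _ _ Hwx Hxy) as Hwy.
rewrite X_unfold in HX.
destruct (HX y (conj Hwy HA)) as [z [Hyz Hz]].
exists z; split.
- exact (vS_trans _ _ _ _ _ (vS_vR _ _ _ _ Hwx Hwy Hxy) Hyz).
- now apply (Z_of_calG _ _ _ x y z); [apply (HF w) | ..].
Qed.

(** * From the scheme to the frame condition *)

Definition level (p : placeholder) : nat :=
  match p with phA n | phB n | phC n | phE n => n end.

Lemma level_XYZ (k : nat) (p : placeholder) :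
  (occurs p (X_ k) -> level p <= k) /\
  (occurs p (Y_ k) -> level p <= k) /\
  (occurs p (Z_ k) -> level p <= k).
Proof.
induction k as [| k [IHX [IHY IHZ]]]; repeat split; cbn; intros H;
  repeat match goal with
  | H : _ \/ _ |- _ => destruct H as [H | H]
  | H : p = _ |- _ => subst p; cbn; lia
  | IH : occurs p ?A -> _, H : occurs p ?A |- _ => apply IH in H; lia
  end.
Qed.

(** With [C_k] the set of [S_x]-successors of [y], the formula [□ C_k] at [z] says
    exactly that every successor of [z] is one of them.  The lower levels stay
    free, to be chosen for each configuration under test. *)
Definition pin {F : veltman_frame} (k : nat) (x y z : F) (E : F -> Prop)
    (val : placeholder -> F -> Prop) (p : placeholder) (t : F) : Prop :=
  if level p =? k then
    match p with
    | phA _ => t = y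
    | phB _ => t = z
    | phC _ => vS x y t
    | phE _ => E t
    end
  else val p t.

Lemma holds_pin (F : veltman_frame) (k : nat) (x y z : F) (E : F -> Prop)
    (val : placeholder -> F -> Prop) (P : scheme) :
  (forall p, occurs p P -> level p <= k) ->
  forall t, holds (pin (S k) x y z E val) t P <-> holds val t P.
Proof.
intros HP; apply holds_ext; intros p t Hp; unfold pin.
now rewrite (proj2 (Nat.eqb_neq _ _)) by (specialize (HP p Hp); lia).
Qed.

Lemma pin_Y_head (F : veltman_frame) (k : nat) (x y z : F) (E : F -> Prop)
    (val : placeholder -> F -> Prop) :
  vR x y -> holds (pin k x y z E val) x (¬ (A_ k ▷ ¬ C_ k)).
Proof.
intros Hxy H; cbn in H; unfold pin in H; cbn in H; rewrite Nat.eqb_refl in H.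
destruct (H y (conj Hxy eq_refl)) as [u [Hu HC]]; exact (HC Hu).
Qed.

Lemma Z_B (F : veltman_frame) (k : nat) (val : placeholder -> F -> Prop) (x : F) :
  holds val x (Z_ k) -> val (phB k) x.
Proof. destruct k; cbn; tauto. Qed.

(** [pinned k w x y z] is what validity of [Rtilde k] gives about [w R x R y] and
    [y S_w z]: once only [z] satisfies [B_k], no other world can force [Z_ k].  This
    form, unlike validity itself, is inherited by the configurations at the lower
    levels, [z] taking the place of [w]. *)
Definition pinned {F : veltman_frame} (k : nat) (w x y z : F) : Prop :=
  forall val : placeholder -> F -> Prop,
  (forall t, val (phA k) t <-> t = y) ->
  (forall t, val (phB k) t <-> t = z) ->
  holds val w (X_ k) -> holds val x (Y_ k) -> holds val z (Z_ k).

(** One level of the scheme: a valuation of the lower levels that makes the lower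
    [X_] true at [z] and lets [x] send [E] to the lower [Y_] is extended by
    [pin], and [Z_ (S k)] at [z] then says all that is asked. *)
Lemma pinned_step (F : veltman_frame) (k : nat) (w x y z : F) :
  vR x y -> vS w y z -> pinned (S k) w x y z ->
  forall (E : F -> Prop) (val : placeholder -> F -> Prop),
  holds val z (X_ k) ->
  (forall u, vR x u -> E u -> exists v, vS x u v /\ holds val v (Y_ k)) ->
  forall u, vR z u ->
    vS x y u /\
    (E u -> (exists a, vS z u a /\ val (phA k) a) /\
            (exists b, vS z u b /\ holds val b (Z_ k))).
Proof.
intros Hxy Hyz Hpin E val HX HEY.
set (val' := pin (S k) x y z E val).
assert (top : forall p t, level p = S k ->
    val' p t = match p with
               | phA _ => t = y | phB _ => t = z
               | phC _ => vS x y t | phE _ => E t end).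
{ intros p t Hp; unfold val', pin; now rewrite Hp, Nat.eqb_refl. }
assert (low : forall P, (forall p, occurs p P -> level p <= k) ->
    forall t, holds val' t P <-> holds val t P) by apply holds_pin.
pose proof (low (X_ k) (fun p => proj1 (level_XYZ k p))) as lowX.
pose proof (low (Y_ k) (fun p => proj1 (proj2 (level_XYZ k p)))) as lowY.
pose proof (low (Z_ k) (fun p => proj2 (proj2 (level_XYZ k p)))) as lowZ.
assert (lowA : forall t, val' (phA k) t <-> val (phA k) t).
{ apply (low (A_ k)); cbn; intros p ->; cbn; lia. }
assert (HZ : holds val' z (Z_ (S k))).
{ apply Hpin.
  - intros t; now rewrite top.
  - intros t; now rewrite top.
  - intros y' [_ Hy']; cbn in Hy'; rewrite top in Hy' by easy; subst y'.
    exists z; split; [exact Hyz |]; split; [cbn; now rewrite top |].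
    now apply lowX.
  - split; [now apply pin_Y_head |].
    intros u [Hxu HE]; cbn in HE; rewrite top in HE by easy.
    destruct (HEY u Hxu HE) as [v [Huv HY]].
    exists v; split; [exact Huv | now apply lowY]. }
cbn [Z_] in HZ; destruct HZ as [[[_ HC] HEA] HEZ].
intros u Hzu; split.
- specialize (HC u Hzu); cbn in HC; now rewrite top in HC.
- intros HE.
  assert (HEu : vR z u /\ holds val' u (E_ (S k)))
    by (split; [exact Hzu | cbn; now rewrite top]).
  split.
  + destruct (HEA u HEu) as [a [Hua Ha]].
    exists a; split; [exact Hua | now apply lowA].
  + destruct (HEZ u HEu) as [b [Hub Hb]].
    exists b; split; [exact Hub | now apply lowZ].
Qed.

Lemma X_of_empty_A (F : veltman_frame) (k : nat) (val : placeholder -> F -> Prop)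
    (x : F) :
  (forall t, ~ val (phA k) t) -> holds val x (X_ k).
Proof.
intros HA; rewrite X_unfold; intros y [_ Hy]; now destruct (HA y).
Qed.

(** Each of the three conjuncts in two layers of [calG] is read off with its own
    valuation of the lower levels: an empty one for [y S_x u], one with [A_k] true
    exactly at [a] for [u S_z a], and an arbitrary one, to be supplied by the
    induction, for the rest. *)
Lemma calG_of_pinned (F : veltman_frame) (k : nat) :
  forall w x y z : F,
  vR x y -> vS w y z -> pinned k w x y z -> calG F (2 * k) x y z.
Proof.
induction k as [| k IH]; intros w x y z Hxy Hyz Hpin.
- set (val := pin 0 x y z (fun _ => False) (fun _ _ => False)).
  assert (HZ : holds val z (Z_ 0)).
  { apply Hpin; [easy | easy | | now apply pin_Y_head].
    intros y' [_ Hy']; cbn in Hy'; subst y'; now exists z. }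
  exact (proj2 HZ).
- replace (2 * S k) with (S (S (2 * k))) by lia.
  pose proof (pinned_step F k w x y z Hxy Hyz Hpin) as step; clear Hpin.
  intros u Hzu; split.
  { apply (step (fun _ => False) (fun _ _ => False)); try easy.
    now apply X_of_empty_A. }
  intros v Huv a Hva; split.
  + set (val := fun p t =>
           match p with
           | phA n => n = k /\ t = a
           | phB _ | phC _ => True
           | phE _ => False
           end).
    destruct (step (fun t => t = u) val) with (u := u) as [_ Hu]; try easy.
    * rewrite X_unfold; intros a' [Ha' _]; exists a'.
      split; [now apply vS_refl |].
      destruct k as [| k]; cbn; [easy |].
      split; [easy |]; apply X_of_empty_A; cbn; intros t; lia.
    * intros u' _ ->; exists v; split; [exact Huv |].
      assert (Hhead : holds val v (¬ (A_ k ▷ ¬ C_ k))).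
      { intros H; destruct (H a) as [c [_ Hc]]; [easy | now apply Hc]. }
      destruct k as [| k]; [exact Hhead |].
      split; [exact Hhead |]; intros t [_ []].
    * destruct (proj1 (Hu eq_refl)) as [a' [Hua [_ ->]]]; exact Hua.
  + intros b Hab.
    apply (IH z v a b Hva Hab); intros val HA HB HX HY.
    destruct (step (fun t => t = u) val) with (u := u) as [_ Hu]; try easy.
    * intros u' _ ->; now exists v.
    * destruct (proj2 (Hu eq_refl)) as [b' [_ HZ]].
      now rewrite (proj1 (HB b') (Z_B _ _ _ _ HZ)) in HZ.
Qed.

Lemma calF_of_valid_Rtilde (F : veltman_frame) (k : nat) :
  valid F (Rtilde k) -> calF F (2 * k).
Proof.
intros H w x y z [Hwx [Hxy Hyz]].
apply (calG_of_pinned F k w); [easy | easy |].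
intros val HA HB HX HY.
destruct (proj1 (valid_iff_holds F (Rtilde k)) H val w HX x (conj Hwx HY))
  as [z' [_ HZ]].
now rewrite (proj1 (HB z') (Z_B _ _ _ _ HZ)) in HZ.
Qed.

(** * A closed form of the replacement schemes *)

(** The three parts of the schemes [Rscheme], with [d] further levels inside level
    [i].  What stands at the innermost level is a parameter, because it is all
    that the replacements change. *)
Fixpoint Xchain (i d : nat) (b : scheme) : scheme :=
  match d with
  | 0 => A_ i ▷ b
  | S d => A_ i ▷ B_ i ∧ Xchain (S i) d b
  end.

Fixpoint Ychain (i d : nat) (y : scheme) : scheme :=
  match d with
  | 0 => y
  | S d => ¬ (A_ i ▷ ¬ C_ i) ∧ (E_ (S i) ▷ Ychain (S i) d y)
  end.

Fixpoint Zchain (i d : nat) (b z : scheme) : scheme :=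
  match d with
  | 0 => z
  | S d =>
      B_ i ∧ Xchain (S i) d b ∧ □ C_ i
        ∧ ((E_ (S i) ▷ A_ (S i)) ∧ (E_ (S i) ▷ Zchain (S i) d b z))
  end.

Definition Rchain (n : nat) (b y z : scheme) : scheme :=
  Xchain 0 n b ⇒ Ychain 0 n y ▷ Zchain 0 n b z.

(** Decides the comparisons made by [replace] on schemes with a visible head, the
    indices being compared by [lia]. *)
Ltac compute_replace :=
  unfold to_odd, to_even, Dia, A_, B_, C_, E_ in *;
  rewrite ?Nat.add_1_r in *;
  cbn [replace lookup];
  repeat match goal with
  | |- context [scheme_eq_dec ?P ?Q] =>
      let e := fresh "e" in
      destruct (scheme_eq_dec P Q) as [e | e];
      [ try (exfalso; injection e; intros; lia); try discriminate e
      | try (exfalso; apply e; reflexivity) ];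
      cbn [replace lookup]
  end.

Section ReplacementInChains.

Variables (n : nat) (r : scheme -> scheme).
Hypothesis r_cases : r = to_odd n \/ r = to_even n.

Lemma replace_Xchain (i d : nat) (b : scheme) :
  i + d = n -> r (Xchain i d b) = Xchain i d (r b).
Proof.
revert i; induction d as [| d IH]; intros i Hi; cbn [Xchain].
- destruct r_cases as [-> | ->]; compute_replace; reflexivity.
- specialize (IH (S i) ltac:(lia)).
  rewrite <- IH; clear IH.
  destruct r_cases as [-> | ->]; compute_replace; reflexivity.
Qed.

Lemma replace_Ychain (i d : nat) (y : scheme) :
  i + d = n -> r (Ychain i d y) = Ychain i d (r y).
Proof.
revert i; induction d as [| d IH]; intros i Hi; cbn [Ychain]; [reflexivity |].
specialize (IH (S i) ltac:(lia)).
rewrite <- IH; clear IH.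
destruct r_cases as [-> | ->]; compute_replace; reflexivity.
Qed.

Lemma replace_Zchain (i d : nat) (b z : scheme) :
  i + d = n -> r (Zchain i d b z) = Zchain i d (r b) (r z).
Proof.
revert i; induction d as [| d IH]; intros i Hi; cbn [Zchain]; [reflexivity |].
specialize (IH (S i) ltac:(lia)).
rewrite <- IH, <- replace_Xchain by lia; clear IH.
destruct r_cases as [-> | ->]; compute_replace; reflexivity.
Qed.

(** The side condition keeps [Ychain 0 n y ▷ Zchain 0 n b z] from being itself one
    of the replaced subformulas. *)
Lemma replace_Rchain (b y z : scheme) :
  (forall m, y <> E_ m) ->
  r (Rchain n b y z) = Rchain n (r b) (r y) (r z).
Proof.
intros Hy; unfold Rchain.
rewrite <- replace_Xchain, <- replace_Ychain, <- replace_Zchain by lia.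
assert (HY : forall m, Ychain 0 n y <> E_ m) by (destruct n; easy).
destruct r_cases as [-> | ->]; unfold to_odd, to_even; cbn [replace lookup].
- repeat (destruct (scheme_eq_dec _ _) as [e | _]; [discriminate e |]).
  reflexivity.
- repeat (destruct (scheme_eq_dec _ _) as [e | _];
    [try discriminate e; injection e; intros; now destruct (HY (n + 1)) |]).
  reflexivity.
Qed.

End ReplacementInChains.

Lemma Xchain_extend (i d : nat) (b : scheme) :
  Xchain i d (B_ (i + d) ∧ (A_ (S (i + d)) ▷ b)) = Xchain i (S d) b.
Proof.
revert i; induction d as [| d IH]; intros i.
- now rewrite Nat.add_0_r.
- rewrite <- Nat.add_succ_comm; cbn [Xchain] in *; now rewrite IH.
Qed.

Lemma Ychain_extend (i d : nat) (y : scheme) :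
  Ychain i d (¬ (A_ (i + d) ▷ ¬ C_ (i + d)) ∧ (E_ (S (i + d)) ▷ y)) =
  Ychain i (S d) y.
Proof.
revert i; induction d as [| d IH]; intros i.
- now rewrite Nat.add_0_r.
- rewrite <- Nat.add_succ_comm; cbn [Ychain] in *; now rewrite IH.
Qed.

Lemma Zchain_extend (i d : nat) (b z : scheme) :
  let n := i + d in
  Zchain i d (B_ n ∧ (A_ (S n) ▷ b))
    (B_ n ∧ (A_ (S n) ▷ b) ∧ □ C_ n ∧ ((E_ (S n) ▷ A_ (S n)) ∧ (E_ (S n) ▷ z))) =
  Zchain i (S d) b z.
Proof.
revert i; induction d as [| d IH]; intros i n; subst n.
- now rewrite Nat.add_0_r.
- cbn zeta in IH; rewrite <- Nat.add_succ_comm.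
  change (Zchain i (S (S d)) b z) with
    (B_ i ∧ Xchain (S i) (S d) b ∧ □ C_ i
      ∧ ((E_ (S i) ▷ A_ (S i)) ∧ (E_ (S i) ▷ Zchain (S i) (S d) b z))).
  rewrite <- IH, <- Xchain_extend; reflexivity.
Qed.

(** Going from [2 * n] to [2 * n + 2] rewrites the innermost level into the
    innermost two levels of a chain that is longer by one. *)
Lemma Rscheme_closed_form (n : nat) :
  Rscheme (2 * n) = Rchain n (B_ n) (¬ (A_ n ▷ ¬ C_ n)) (B_ n ∧ □ C_ n).
Proof.
induction n as [| n IH]; [reflexivity |].
replace (2 * S n) with (2 * n + 2) by lia.
rewrite Rscheme_even, Rscheme_odd, IH; clear IH.
assert (HB : to_odd n (B_ n) = B_ n) by (compute_replace; reflexivity).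
assert (HY : to_odd n (¬ (A_ n ▷ ¬ C_ n)) =
    (¬ (A_ n ▷ ¬ C_ n) ∧ (E_ (S n) ▷ ◇ A_ (S n))))
  by (compute_replace; reflexivity).
assert (HZ : to_odd n (B_ n ∧ □ C_ n) =
    (B_ n ∧ □ C_ n ∧ (E_ (S n) ▷ A_ (S n))))
  by (compute_replace; reflexivity).
rewrite (replace_Rchain n _ (or_introl eq_refl)), HB, HY, HZ by easy.
clear HB HY HZ.
assert (HB : to_even n (B_ n) = (B_ n ∧ (A_ (S n) ▷ B_ (S n))))
  by (compute_replace; reflexivity).
assert (HY : to_even n (¬ (A_ n ▷ ¬ C_ n) ∧ (E_ (S n) ▷ ◇ A_ (S n))) =
    (¬ (A_ n ▷ ¬ C_ n) ∧ (E_ (S n) ▷ ¬ (A_ (S n) ▷ ¬ C_ (S n)))))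
  by (compute_replace; reflexivity).
assert (HZ : to_even n (B_ n ∧ □ C_ n ∧ (E_ (S n) ▷ A_ (S n))) =
    (B_ n ∧ (A_ (S n) ▷ B_ (S n)) ∧ □ C_ n
      ∧ ((E_ (S n) ▷ A_ (S n)) ∧ (E_ (S n) ▷ B_ (S n) ∧ □ C_ (S n)))))
  by (compute_replace; reflexivity).
rewrite (replace_Rchain n _ (or_intror eq_refl)), HB, HY, HZ by easy.
unfold Rchain.
exact (f_equal2 Imp (Xchain_extend 0 n _)
        (f_equal2 Rhd (Ychain_extend 0 n _) (Zchain_extend 0 n _ _))).
Qed.

(** * Reversing the numbering of the levels *)

(** Reflection of [0, ..., N], extended by the identity so as to be an involution
    of all natural numbers. *)
Definition reflect_nat (N i : nat) : nat := if i <=? N then N - i else i.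

Arguments reflect_nat : simpl never.

Lemma reflect_natE (N i : nat) : i <= N -> reflect_nat N i = N - i.
Proof. intros H; unfold reflect_nat; now rewrite (proj2 (Nat.leb_le _ _) H). Qed.

Lemma reflect_natK (N i : nat) : reflect_nat N (reflect_nat N i) = i.
Proof.
unfold reflect_nat at 2; destruct (Nat.leb_spec i N) as [H | H].
- rewrite reflect_natE; lia.
- unfold reflect_nat; destruct (Nat.leb_spec i N); lia.
Qed.

(** The placeholder [E] that links two neighbouring levels carries the larger of
    their two indices, hence its shift by one. *)
Definition mirror (N : nat) (p : placeholder) : placeholder :=
  match p with
  | phA i => phA (reflect_nat N i)
  | phB i => phB (reflect_nat N i)
  | phC i => phC (reflect_nat N i)
  | phE i => phE (reflect_nat (S N) i)
  end.

Lemma mirrorK (N : nat) (p : placeholder) : mirror N (mirror N p) = p.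
Proof. destruct p; cbn; now rewrite reflect_natK. Qed.

Section Mirror.

Variables (F : veltman_frame) (N : nat) (val : placeholder -> F -> Prop).

Let val' (p : placeholder) : F -> Prop := val (mirror N p).

Lemma holds_mirror_X (d : nat) :
  d <= N -> forall x,
  holds val' x (X_ d) <-> holds val x (Xchain (N - d) d (B_ N)).
Proof.
induction d as [| d IH]; intros Hd x; cbn [X_ Xchain holds A_ B_];
  apply Rhd_iff; intros t; unfold val'; cbn; rewrite reflect_natE by lia;
  try reflexivity.
- now rewrite Nat.sub_0_r.
- replace (S (N - S d)) with (N - d) by lia.
  now rewrite <- IH by lia.
Qed.

Lemma holds_mirror_head (d : nat) :
  d <= N -> forall x,
  holds val' x (¬ (A_ d ▷ ¬ C_ d)) <->
  holds val x (¬ (A_ (N - d) ▷ ¬ C_ (N - d))).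
Proof. intros Hd x; unfold val'; cbn; now rewrite reflect_natE by lia. Qed.

Lemma holds_mirror_Y (d : nat) :
  d <= N -> forall x,
  holds val' x (Y_ d) <->
  holds val x (Ychain (N - d) d (¬ (A_ N ▷ ¬ C_ N))).
Proof.
induction d as [| d IH]; intros Hd x.
- pose proof (holds_mirror_head 0 Hd x) as H; now rewrite Nat.sub_0_r in H.
- change (holds val' x (¬ (A_ (S d) ▷ ¬ C_ (S d))) /\
          holds val' x (E_ (S d) ▷ Y_ d) <->
          holds val x (¬ (A_ (N - S d) ▷ ¬ C_ (N - S d))) /\
          holds val x (E_ (S (N - S d)) ▷
            Ychain (S (N - S d)) d (¬ (A_ N ▷ ¬ C_ N)))).
  rewrite holds_mirror_head by lia.
  apply and_iff_compat_l, Rhd_iff; intros t.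
  + unfold val'; cbn [holds E_ mirror]; rewrite reflect_natE by lia.
    now replace (S N - S d) with (S (N - S d)) by lia.
  + replace (S (N - S d)) with (N - d) by lia; apply IH; lia.
Qed.

Lemma holds_mirror_Z (d : nat) :
  d <= N -> forall x,
  holds val' x (Z_ d) <->
  holds val x (Zchain (N - d) d (B_ N) (B_ N ∧ □ C_ N)).
Proof.
induction d as [| d IH]; intros Hd x.
- unfold val'; cbn; now rewrite reflect_natE, Nat.sub_0_r by lia.
- cbn [Z_ Zchain].
  replace (S (N - S d)) with (N - d) by lia.
  assert (HE : forall t, val' (phE (S d)) t <-> val (phE (N - d)) t).
  { intros t; unfold val'; cbn [mirror]; rewrite reflect_natE by lia.
    now replace (S N - S d) with (N - d) by lia. }
  assert (HEA : holds val' x (E_ (S d) ▷ A_ d) <->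
                holds val x (E_ (N - d) ▷ A_ (N - d))).
  { apply Rhd_iff; [exact HE |]; intros t; unfold val'; cbn.
    now rewrite reflect_natE by lia. }
  assert (HEZ : holds val' x (E_ (S d) ▷ Z_ d) <->
      holds val x (E_ (N - d) ▷ Zchain (N - d) d (B_ N) (B_ N ∧ □ C_ N))).
  { apply Rhd_iff; [exact HE |]; intros t; apply IH; lia. }
  assert (HBC : (holds val' x (B_ (S d)) <-> holds val x (B_ (N - S d))) /\
      (holds val' x (□ C_ (S d)) <-> holds val x (□ C_ (N - S d)))).
  { unfold val'; cbn; now rewrite reflect_natE by lia. }
  pose proof (holds_mirror_X d ltac:(lia) x) as HX.
  cbn [holds] in *; tauto.
Qed.

Lemma holds_mirror_Rtilde (x : F) :
  holds val' x (Rtilde N) <-> holds val x (Rscheme (2 * N)).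
Proof.
rewrite Rscheme_closed_form; unfold Rchain, Rtilde.
pose proof (holds_mirror_X N (le_n N)) as HX.
pose proof (holds_mirror_Y N (le_n N)) as HY.
pose proof (holds_mirror_Z N (le_n N)) as HZ.
rewrite Nat.sub_diag in HX, HY, HZ.
cbn [holds]; rewrite HX.
apply imp_iff_compat_l, Rhd_iff; [apply HY | apply HZ].
Qed.

End Mirror.

Lemma valid_Rtilde_iff_Rscheme (F : veltman_frame) (k : nat) :
  valid F (Rtilde k) <-> valid F (Rscheme (2 * k)).
Proof.
rewrite !valid_iff_holds; split; intros H val x.
- apply holds_mirror_Rtilde, H.
- apply (holds_ext _ _ val (fun p => val (mirror k (mirror k p)))).
  + intros p t _; now rewrite mirrorK.
  + apply (holds_mirror_Rtilde F k (fun p => val (mirror k p))), H.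
Qed.

Theorem theorem3p6 (F : veltman_frame) (k : nat) :
  (calF F (2 * k) <-> valid F (Rtilde k)) /\
  (valid F (Rtilde k) <-> valid F (Rscheme (2 * k))).
Proof.
split; [split |].
- apply valid_Rtilde_of_calF.
- apply calF_of_valid_Rtilde.
- apply valid_Rtilde_iff_Rscheme.
Qed.
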